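(* Suppose that the maps $(T_{ab})_{(a,b)\in\mathcal{A}\times\mathcal{B}}$ are almost-isometries with a uniform constant, i.e. there is $\gamma\in\mathbb{R}$ such that $d(T_{ab}(x),T_{ab}(y))\geq d(x,y)-\gamma$ for all $x,y\in X$ and all $(a,b)\in\mathcal{A}\times\mathcal{B}$. Then the value $\rho$ of the escape rate game satisfies \[ \rho=\inf\{\lambda\in\mathbb{R}\mid \exists\, v\in\mathscr{D},\ \lambda+v\geq Sv\}=\inf_{v\in\mathscr{D}}\ \sup_{x\in X}\big(Sv(x)-v(x)\big). \]
   Context: A hemi-metric on a nonempty set $X$ is a map $d:X\times X\to\mathbb{R}$ (possibly negative, not necessarily symmetric) such that $d(x,z)\leq d(x,y)+d(y,z)$ for all $x,y,z$, and $d(x,y)=d(y,x)=0$ if and only if $x=y$. The space $X$ carries the topology of the metric $d^\circ(x,y)=\max(d(x,y),d(y,x))$. A self-map $T$ of $X$ is nonexpansive if $d(T(x),T(y))\leq d(x,y)$ for all $x,y$. Setting: $(X,d)$ is a hemi-metric space, $\mathcal{A},\mathcal{B}$ are nonempty compact sets (action spaces), and for each $(a,b)\in\mathcal{A}\times\mathcal{B}$, $T_{ab}:X\to X$ is nonexpansive. Standing assumption: for all $x\in X$ the maps $b\mapsto T_{ab}(x)$ (each $a$) and $a\mapsto T_{ab}(x)$ (each $b$) are continuous, and for every compact $K\subset X$ the set $\{T_{ab}(x)\mid (a,b,x)\in\mathcal{A}\times\mathcal{B}\times K\}$ is compact. $\mathrm{Lip}_1$ is the set of functions $v:X\to\mathbb{R}$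 with $v(x)-v(y)\leq d(x,y)$ for all $x,y\in X$. The Shapley operator $S:\mathrm{Lip}_1\to\mathrm{Lip}_1$ is $Sv(x)=\inf_{a\in\mathcal{A}}\sup_{b\in\mathcal{B}}v(T_{ab}(x))$. A function $v\in\mathrm{Lip}_1$ is distance-like if, for some (equivalently every) $x_0\in X$, there is $\alpha\in\mathbb{R}$ with $v(x)\geq d(x,x_0)+\alpha$ for all $x\in X$; $\mathscr{D}$ is the set of distance-like functions. Escape rate game: from an initial state $x_0\in X$, at each turn $k\geq1$ player Min chooses $a_k\in\mathcal{A}$, then player Max, having observed $a_k$, chooses $b_k\in\mathcal{B}$, and $x_k=T_{a_kb_k}(x_{k-1})$. A strategy $\sigma$ of Min maps each finite history $(x_0,a_1,b_1,x_1,\dots,a_k,b_k,x_k)$ to an element of $\mathcal{A}$; a strategy $\tau$ of Max maps each such history together with Min's next action to an element of $\mathcal{B}$. Let $J_k(\sigma,\tau)=d(x_k,x_0)$ for the play generated by $(\sigma,\tau)$. Min minimizes and Max maximizes the escape rate $J_\infty(\sigma,\tau)=\limsup_{k\to\infty}J_k(\sigma,\tau)/k$. The value of the game is $\rho=\inf_\sigma\sup_\tau J_\infty(\sigma,\tau)=\sup_\tau\inf_\sigma J_\infty(\sigma,\tau)$; it exists (even as a uniform value), does not depend on $x_0$, and equals $\lim_{k\to\infty}[S^kd(\cdot,x_0)](x_0)/k$. *)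

(* Defs.v *)
From mathcomp Require Import all_boot all_order all_algebra.
From mathcomp Require Import all_classical all_reals all_analysis.

Set Implicit Arguments.
Unset Strict Implicit.
Unset Printing Implicit Defensive.

Import Order.TTheory GRing.Theory Num.Theory.

Local Open Scope classical_set_scope.
Local Open Scope ring_scope.

(* A hemi-metric is neither required to be symmetric nor nonnegative. *)
Definition hemi_metric (R : realType) (X : Type) (d : X -> X -> R) : Prop :=
  (forall x y z, d x z <= d x y + d y z) /\
  (forall x y, (d x y = 0 /\ d y x = 0) <-> x = y).

Definition symmetrized (R : realType) (X : Type) (d : X -> X -> R)
  (x y : X) : R := Num.max (d x y) (d y x).

(* The topology carried by X is the one of the metric [symmetrized d]. *)
Definition hemi_metric_topology (R : realType) (X : topologicalType)
    (d : X -> X -> R) : Prop :=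
  forall (x : X) (U : set X),
    nbhs x U <->
    exists2 e : R, 0 < e & [set y | symmetrized d x y < e] `<=` U.

Definition nonexpansive (R : realType) (X : Type) (d : X -> X -> R)
    (f : X -> X) : Prop :=
  forall x y, d (f x) (f y) <= d x y.

Definition game_assumption (X A B : topologicalType)
    (T : A -> B -> X -> X) : Prop :=
  [/\ forall (a : A) (x : X), continuous (fun b : B => T a b x),
      forall (b : B) (x : X), continuous (fun a : A => T a b x) &
      forall K : set X, compact K ->
        compact [set y : X | exists a b x, K x /\ y = T a b x]].

Definition Lip1 (R : realType) (X : Type) (d : X -> X -> R) : set (X -> R) :=
  [set v | forall x y, v x - v y <= d x y].

(* The real-valued [inf] and [sup] are those of bounded sets when v is in
   [Lip1 d]: v is then continuous, and the states T a b x stay in a compact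
   set when a and b vary. *)
Definition shapley (R : realType) (X A B : Type) (T : A -> B -> X -> X)
    (v : X -> R) (x : X) : R :=
  inf (range (fun a : A => sup (range (fun b : B => v (T a b x))))).

Definition distance_like (R : realType) (X : Type) (d : X -> X -> R) :
    set (X -> R) :=
  [set v | Lip1 d v /\
    exists (x0 : X) (alpha : R), forall x, d x x0 + alpha <= v x].

Section EscapeRateGame.
Variables (R : realType) (X A B : Type).
Variables (d : X -> X -> R) (T : A -> B -> X -> X).

(* (x_0, [:: (a_1, b_1, x_1); ...; (a_k, b_k, x_k)]), in chronological order. *)
Definition history : Type := (X * seq (A * B * X))%type.

Definition current_state (h : history) : X :=
  last h.1 [seq turn.2 | turn <- h.2].

Definition min_strategy : Type := history -> A.
Definition max_strategy : Type := history -> A -> B.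

Fixpoint play (x0 : X) (sigma : min_strategy) (tau : max_strategy) (k : nat) :
    history :=
  if k is k'.+1 then
    let h := play x0 sigma tau k' in
    let a := sigma h in
    let b := tau h a in
    (h.1, rcons h.2 (a, b, T a b (current_state h)))
  else (x0, [::]).

Definition payoff (x0 : X) (sigma : min_strategy) (tau : max_strategy)
    (k : nat) : R :=
  d (current_state (play x0 sigma tau k)) x0.

Definition escape_rate (x0 : X) (sigma : min_strategy) (tau : max_strategy) :
    \bar R :=
  limn_esup (fun k : nat => (payoff x0 sigma tau k / k%:R)%:E).

Definition upper_value (x0 : X) : \bar R :=
  ereal_inf (range (fun sigma : min_strategy =>
    ereal_sup (range (fun tau : max_strategy => escape_rate x0 sigma tau)))).

Definition lower_value (x0 : X) : \bar R :=
  ereal_sup (range (fun tau : max_strategy =>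
    ereal_inf (range (fun sigma : min_strategy => escape_rate x0 sigma tau)))).

Definition is_game_value (x0 : X) (rho : \bar R) : Prop :=
  upper_value x0 = rho /\ lower_value x0 = rho.

End EscapeRateGame.

(* Main.v *)
(* Let rho be the infimum of the lam admitting a distance-like v with
   S v <= lam + v.  Playing greedily with respect to such a v, Min keeps the
   escape rate below lam; dually, a 1-Lipschitz v with lam + v <= S v lets Max
   keep it above lam.  The point is that for every lam one of the two exists.
   Let g_n be the value of the game of at most n turns in which Min may stop at
   any turn k and then pays d(x_k, x0) - k lam.  If g_n(x0) >= 0 for all n, the
   decreasing sequence g_n is bounded below and, by Dini's theorem on the
   compact sets {T_ab(x)}, its limit v satisfies lam + v <= S v.  If g_n(x0) < 0 for
   some n, then v = min_(i <= n) (g_i + i e), with e > 0 small, satisfies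
   S v <= lam + v; it is distance-like because almost-isometries bound each g_i
   below by d(., x0) up to a constant. *)
Require Import Defs.
From mathcomp Require Import all_boot all_order all_algebra.
From mathcomp Require Import all_classical all_reals all_analysis.
From mathcomp Require Import lra.

Set Implicit Arguments.
Unset Strict Implicit.
Unset Printing Implicit Defensive.

Import Order.TTheory GRing.Theory Num.Theory.

Local Open Scope classical_set_scope.
Local Open Scope ring_scope.

(** * Growth rates of sequences with linear bounds *)

Section LinearGrowth.
Context (R : realType).
Implicit Types (u : nat -> R) (C c : R).

Lemma limn_esup_le_slope u C c : (forall k, u k <= C + k%:R * c) ->
  (limn_esup (fun k => (u k / k%:R)%:E) <= c%:E)%E.
Proof.
move=> uC; apply/lee_addgt0Pr => e e0; apply: ge_ereal_inf.
have near_k : \forall k \near \oo, u k / k%:R <= c + e.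
  near=> k.
  have k0 : 0 < k%:R :> R by rewrite ltr0n; near: k; exact: nbhs_infty_gt.
  (* From this rank on, [C] adds at most [e] to the quotient. *)
  have Ck : C / e <= k%:R by near: k; exact: nbhs_infty_ger.
  rewrite ler_pdivrMr// (le_trans (uC k))//.
  rewrite ler_pdivrMr// in Ck; nra.
by eexists; [eexists; [exact: near_k|by []]|
  apply: ge_ereal_sup => _ [k + <-]; rewrite -EFinD lee_fin].
Unshelve. all: by end_near. Qed.

Lemma limn_esup_ge_slope u C c : (forall k, C + k%:R * c <= u k) ->
  (c%:E <= limn_esup (fun k => (u k / k%:R)%:E))%E.
Proof.
move=> uC; apply: le_ereal_inf_tmp => _ [V V_oo <-].
apply/lee_addgt0Pr => e e0; rewrite -leeBlDr//.
have [k [Vk k_large]] : exists k, V k /\ c - e <= u k / k%:R.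
  near \oo => k; exists k; split; first by near: k.
  have k0 : 0 < k%:R :> R by rewrite ltr0n; near: k; exact: nbhs_infty_gt.
  have Ck : - C / e <= k%:R by near: k; exact: nbhs_infty_ger.
  rewrite ler_pdivlMr// (le_trans _ (uC k))//.
  rewrite ler_pdivrMr// in Ck; nra.
by apply: le_ereal_sup_tmp; exists (u k / k%:R)%:E;
  [exists k|rewrite -EFinB lee_fin].
Unshelve. all: by end_near. Qed.

End LinearGrowth.

(** * The Shapley operator on 1-Lipschitz functions *)

Section Shapley.
Context (R : realType) (X : topologicalType) (A B : Type).
Context (d : X -> X -> R) (T : A -> B -> X -> X) (a0 : A) (b0 : B).
Hypothesis d_hemi_metric : hemi_metric d.
Hypothesis X_topology : hemi_metric_topology d.
Hypothesis T_nonexpansive : forall a b, nonexpansive d (T a b).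
Hypothesis T_compact :
  forall x, compact [set y : X | exists a b, y = T a b x].
Implicit Types (u v : X -> R) (x y z : X) (lam : R).

Local Notation S := (shapley T).

Lemma hemi_metric_triangle x y z : d x z <= d x y + d y z.
Proof. by have [] := d_hemi_metric. Qed.

Lemma nbhs_symmetrized x (e : R) : 0 < e ->
  nbhs x [set y | symmetrized d x y < e].
Proof. by move=> e0; apply/X_topology; exists e. Qed.

Lemma Lip1_dist z : Lip1 d (d^~ z).
Proof. by move=> x y /=; have := hemi_metric_triangle x y z; lra. Qed.

Lemma Lip1_distN z : Lip1 d (fun x => - d z x).
Proof. by move=> x y /=; have := hemi_metric_triangle z x y; lra. Qed.

Lemma Lip1_symmetrized v x y (e : R) : Lip1 d v -> symmetrized d x y < e ->
  v x - e < v y < v x + e.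
Proof.
move=> vL; rewrite /symmetrized gt_max => /andP[dxy dyx].
by have := vL x y; have := vL y x; lra.
Qed.

(** Near-covering compactness merges the local bounds of the continuous [v] into one. The real [inf]
    and [sup] in [shapley] are then genuine bounds, not default values. *)
Lemma Lip1_bounded v x : Lip1 d v ->
  exists M : R, forall a b, - M <= v (T a b x) <= M.
Proof.
move=> vL; have /compact_near_coveringP cover := @T_compact x.
have [|N _ /(_ N (leqnn N)) bound] :=
  cover nat \oo (fun n y => - n%:R <= v y <= n%:R) eventually_filter.
  move=> y _.
  exists ([set y' | symmetrized d y y' < 1], [set n | `|v y| + 1 <= n%:R]).
    by split; [exact: nbhs_symmetrized|exact: nbhs_infty_ger].
  move=> [y' n] /= [/(Lip1_symmetrized vL)] vy' vyn.
  by have := ler_norm (v y); have := ler_norm (- v y); rewrite normrN; lra.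
by exists N%:R => a b; apply: bound; exists a, b.
Qed.

(** An index good at [y] stays good by monotonicity. It serves a whole ball around [y], with one
    error [e / 3] each for [g m], for [h] and for the gap at [y]. *)
Lemma dini_Lip1 (g : nat -> X -> R) (h : X -> R) x (e : R) :
    (forall n, Lip1 d (g n)) -> Lip1 d h ->
    (forall y, {homo g^~ y : m n / (m <= n)%N >-> n <= m}) ->
    (forall y (e' : R), 0 < e' -> exists n, g n y < h y + e') ->
  0 < e -> exists n, forall a b, g n (T a b x) <= h (T a b x) + e.
Proof.
move=> gL hL g_mono gh e0; have /compact_near_coveringP cover := @T_compact x.
have e3 : 0 < e / 3 by lra.
have [|N _ /(_ N (leqnn N)) bound] :=
  cover nat \oo (fun n y => g n y <= h y + e) eventually_filter.
  move=> y _; have [m gm] := gh y _ e3.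
  exists ([set y' | symmetrized d y y' < e / 3], [set n | (m <= n)%N]).
    by split; [exact: nbhs_symmetrized|exact: nbhs_infty_ge].
  move=> [y' n] /= [yy' mn].
  have := g_mono y' _ _ mn; have := Lip1_symmetrized hL yy'.
  by have := Lip1_symmetrized (gL m) yy'; lra.
by exists N => a b; apply: bound; exists a, b.
Qed.

(** Strict inequalities yield actual actions, so optimal ones need not be shown to exist. *)
Lemma shapley_lt v x (c : R) : Lip1 d v -> S v x < c ->
  exists a, forall b, v (T a b x) < c.
Proof.
move=> /(Lip1_bounded x) [M vM].
move=> /inf_lt [|_ [a _ <-] supc]; first by eexists; exists a0.
exists a => b; apply: le_lt_trans supc; apply: ub_le_sup; last by exists b.
by exists M => _ [b' _ <-]; have := vM a b'; lra.
Qed.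

Lemma shapley_gt v x (c : R) a : Lip1 d v -> c < S v x ->
  exists b, c < v (T a b x).
Proof.
move=> /(Lip1_bounded x) [M vM] cS.
have : c < sup (range (fun b => v (T a b x))).
  apply: (lt_le_trans cS); apply: ge_inf; last by exists a.
  exists (- M) => _ [a' _ <-]; apply: (@le_trans _ _ (v (T a' b0 x))).
    by have := vM a' b0; lra.
  apply: ub_le_sup; last by exists b0.
  by exists M => _ [b' _ <-]; have := vM a' b'; lra.
by move=> /sup_gt [|_ [b _ <-]]; [exists (v (T a b0 x)), b0|exists b].
Qed.

Lemma shapley_le v x (c : R) a : Lip1 d v ->
  (forall b, v (T a b x) <= c) -> S v x <= c.
Proof.
move=> vL vc; rewrite leNgt; apply/negP => /(shapley_gt a vL) [b].
by rewrite ltNge vc.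
Qed.

Lemma shapley_ge v x (c : R) : Lip1 d v ->
  (forall a, exists b, c <= v (T a b x)) -> c <= S v x.
Proof.
move=> vL vc; rewrite leNgt; apply/negP => /(shapley_lt vL) [a va].
by have [b] := vc a; rewrite leNgt va.
Qed.

(** Letting both the function and the point vary covers at once monotonicity, the effect of additive
    constants and preservation of [Lip1]. *)
Lemma shapley_le_add u v x y (c : R) : Lip1 d u -> Lip1 d v ->
  (forall a b, u (T a b x) <= v (T a b y) + c) -> S u x <= S v y + c.
Proof.
move=> uL vL uv; apply/ler_addgt0Pr => e e0.
have /(shapley_lt vL) [a va] : S v y < S v y + e by lra.
by apply: (@shapley_le _ _ _ a) => // b; have := va b; have := uv a b; lra.
Qed.

Lemma shapley_Lip1 v : Lip1 d v -> Lip1 d (S v).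
Proof.
move=> vL x y; rewrite lerBlDl; apply: shapley_le_add => // a b.
by have := vL (T a b x) (T a b y); have := T_nonexpansive a b x y; lra.
Qed.

Lemma min_Lip1 u v : Lip1 d u -> Lip1 d v ->
  Lip1 d (fun x => Num.min (u x) (v x)).
Proof.
move=> uL vL x y; have := uL x y; have := vL x y.
by case: (leP (u x) (v x)) => uvx; case: (leP (u y) (v y)) => uvy; lra.
Qed.

(** * From sub- and supersolutions to values; the game with stopping *)

Lemma current_stateS x0 (sigma : min_strategy X A B) (tau : max_strategy X A B)
    k (h := play T x0 sigma tau k) :
  current_state (play T x0 sigma tau k.+1) =
  T (sigma h) (tau h (sigma h)) (current_state h).
Proof. by rewrite /current_state /= map_rcons last_rcons. Qed.

Lemma upper_value_le v lam x0 : distance_like d v ->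
  (forall x, S v x <= lam + v x) -> (upper_value d T x0 <= lam%:E)%E.
Proof.
move=> [vL [y0 [alpha v_ge]]] vS; apply/lee_addgt0Pr => e e0.
have /choice [f f_lt] x : exists a, forall b, v (T a b x) < lam + v x + e.
  by apply: shapley_lt => //; have := vS x; lra.
pose sigma (h : history X A B) := f (current_state h).
apply: ge_ereal_inf; eexists; first by exists sigma.
apply: ge_ereal_sup => _ [tau _ <-]; rewrite -EFinD.
(* The triangle inequality through [y0] gives [d y x0 <= v y - alpha + d y0 x0]. *)
apply: (@limn_esup_le_slope _ _ (v x0 - alpha + d y0 x0)) => k.
have vk : v (current_state (play T x0 sigma tau k)) <= v x0 + k%:R * (lam + e).
  elim: k => [|k IHk]; first by rewrite mul0r addr0.
  rewrite current_stateS -natr1.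
  have := f_lt (current_state (play T x0 sigma tau k))
    (tau (play T x0 sigma tau k) (sigma (play T x0 sigma tau k))).
  by rewrite -/(sigma _); lra.
rewrite /payoff; move: (current_state _) vk => y vk.
by have := hemi_metric_triangle y y0 x0; have := v_ge y; lra.
Qed.

Lemma lower_value_ge v lam x0 : Lip1 d v ->
  (forall x, lam + v x <= S v x) -> (lam%:E <= lower_value d T x0)%E.
Proof.
move=> vL vS; apply/lee_addgt0Pr => e e0; rewrite -leeBlDr// -EFinB.
(* Max observes Min's action, so the reply is chosen per pair (action, state). *)
have /choice [f f_gt] (ax : A * X) :
    exists b, lam + v ax.2 - e < v (T ax.1 b ax.2).
  by apply: shapley_gt => //; have := vS ax.2; lra.
pose tau (h : history X A B) a := f (a, current_state h).
apply: le_ereal_sup_tmp; eexists; first by exists tau.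
apply: le_ereal_inf_tmp => _ [sigma _ <-].
(* The constant is 0 because [v y - v x0 <= d y x0]. *)
apply: (@limn_esup_ge_slope _ _ 0) => k.
have vk : v x0 + k%:R * (lam - e) <= v (current_state (play T x0 sigma tau k)).
  elim: k => [|k IHk]; first by rewrite mul0r addr0.
  rewrite current_stateS -natr1.
  have := f_gt (sigma (play T x0 sigma tau k),
    current_state (play T x0 sigma tau k)).
  by rewrite -/(tau _ _) /=; lra.
rewrite /payoff; move: (current_state _) vk => y vk.
by have := vL y x0; lra.
Qed.

Lemma lower_upper_value x0 : (lower_value d T x0 <= upper_value d T x0)%E.
Proof.
apply: ge_ereal_sup => _ [tau _ <-]; apply: le_ereal_inf_tmp => _ [sigma _ <-].
apply: (@le_trans _ _ (escape_rate d T x0 sigma tau)).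
  by apply: ereal_inf_lbound; exists sigma.
by apply: ereal_sup_ubound; exists tau.
Qed.

(* Value of the game of at most [n] turns in which Min may stop at any turn
   [k], and then pays [d x_k x0 - k * lam]. *)
Definition stopped_value lam x0 n : X -> R :=
  iter n (fun v x => Num.min (v x) (S v x - lam)) (d^~ x0).

Lemma stopped_value_Lip1 lam x0 n : Lip1 d (stopped_value lam x0 n).
Proof.
elim: n => [|n IHn]; first exact: Lip1_dist.
apply: min_Lip1 => // x y; have := shapley_Lip1 IHn x y.
by rewrite -/(stopped_value lam x0 n); lra.
Qed.

Lemma stopped_value_homo lam x0 x :
  {homo (stopped_value lam x0)^~ x : m n / (m <= n)%N >-> n <= m}.
Proof. by apply/nonincreasing_seqP => n; rewrite /= ge_min lexx. Qed.

(** One turn lowers the distance to [x0] by at most [gamma + M], since [d (T a b x) x0 >= d (T a b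
    x) (T a b x0) - d x0 (T a b x0)]. The maximum below covers both stopping and continuing. *)
Lemma stopped_value_ge lam x0 n (gamma : R) :
    (forall a b x y, d (T a b x) (T a b y) >= d x y - gamma) ->
  exists c : R, forall x, d x x0 - c <= stopped_value lam x0 n x.
Proof.
move=> T_ge; elim: n => [|n [c IHn]]; first by exists 0 => x /=; lra.
have [M xM] := Lip1_bounded x0 (Lip1_distN x0).
exists (Num.max c (c + gamma + M + lam)) => x.
have S_ge : d x x0 - c - gamma - M <= S (stopped_value lam x0 n) x.
  apply: shapley_ge; first exact: stopped_value_Lip1.
  move=> a; exists b0; have := IHn (T a b0 x); have := T_ge a b0 x x0.
  have := hemi_metric_triangle (T a b0 x) x0 (T a b0 x0).
  by have := xM a b0; lra.
rewrite /= le_min -/(stopped_value lam x0 n) !lerBlDr.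
have := IHn x; have : c <= Num.max c (c + gamma + M + lam).
  by rewrite le_max lexx.
have : c + gamma + M + lam <= Num.max c (c + gamma + M + lam).
  by rewrite le_max lexx orbT.
by move=> *; apply/andP; split; lra.
Qed.

(* The minimum defining [v x] is never attained at [i = 0] (as
   [g n x <= d x x0 + g n x0]); if it is attained at [i.+1], the slope [e] rules
   out [g i.+1 x = g i x], so that [g i.+1 x = S (g i) x - lam]. *)
Lemma distance_like_supersolution lam x0 n (gamma : R) :
    (forall a b x y, d (T a b x) (T a b y) >= d x y - gamma) ->
    stopped_value lam x0 n x0 < 0 ->
  exists2 v : X -> R, distance_like d v & forall x, S v x <= lam + v x.
Proof.
move=> T_ge; set g := stopped_value lam x0 => gn_lt0.
(* With [n.+1] rather than [n], [g n x0 + n%:R * e = - e] is strictly negative, which excludes the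
   index 0. *)
pose e := - g n x0 / n.+1%:R.
have e0 : 0 < e by rewrite divr_gt0 ?ltr0n// oppr_gt0.
pose f i x := g i x + i%:R * e.
pose argmin x := [arg min_(i < ord0 : 'I_n.+1) f i x]%O.
pose v x := f (argmin x) x.
have v_le x i : (i <= n)%N -> v x <= f i x.
  rewrite /v /argmin -ltnS => i_n; case: arg_minP => // j _ /(_ (Ordinal i_n)).
  by apply.
have vL : Lip1 d v.
  move=> x y; have := v_le x (argmin y) (ltn_ord (argmin y)).
  have := stopped_value_Lip1 lam x0 (argmin y) x y.
  by rewrite /v /f -/g; lra.
exists v.
  split=> //; exists x0; have [c g_ge] := stopped_value_ge lam x0 n T_ge.
  exists (- c) => x; apply: le_trans (g_ge x) _.
  have := stopped_value_homo lam x0 x (ltn_ord (argmin x) : argmin x <= n)%N.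
  have : 0 <= (argmin x)%:R * e by rewrite mulr_ge0// ltW.
  by rewrite /v /f -/g; lra.
move=> x; case i_min : (nat_of_ord (argmin x)) (ltn_ord (argmin x)) => [|i] i_n.
  have := v_le x n (leqnn n); rewrite /v i_min /f mul0r addr0.
  have := stopped_value_Lip1 lam x0 n x x0; rewrite -/g.
  have : n.+1%:R * e = - g n x0 by rewrite mulrC divfK// pnatr_eq0.
  by rewrite -natr1 /g /=; lra.
have vx : v x = g i.+1 x + i%:R * e + e.
  by rewrite /v i_min /f -natr1; lra.
have S_le : S v x <= S (g i) x + i%:R * e.
  apply: shapley_le_add => //; first exact: stopped_value_Lip1.
  by move=> a b; apply: v_le; exact: ltnW.
have := v_le x i (ltnW i_n); rewrite /f.
have : g i.+1 x = Num.min (g i x) (S (g i) x - lam) by [].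
by case: (leP (g i x) (S (g i) x - lam)) => _ gE; lra.
Qed.

Lemma Lip1_subsolution lam x0 : (forall n, 0 <= stopped_value lam x0 n x0) ->
  exists2 v : X -> R, Lip1 d v & forall x, lam + v x <= S v x.
Proof.
set g := stopped_value lam x0 => g_ge0.
(* The sign at [x0] alone bounds the whole sequence below at every point. *)
have g_lb x n : - d x0 x <= g n x.
  have := stopped_value_Lip1 lam x0 n x0 x; have := g_ge0 n.
  by rewrite -/g; lra.
pose v x := inf (range (g^~ x)).
have v_le x n : v x <= g n x.
  apply: ge_inf; last by exists n.
  by exists (- d x0 x) => _ [m _ <-].
have v_lt x (c : R) : v x < c -> exists n, g n x < c.
  by move=> /inf_lt [|_ [n _ <-]]; [eexists; exists 0%N|exists n].
have vL : Lip1 d v.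
  move=> x y; rewrite lerBlDl; apply/ler_addgt0Pr => e e0.
  have [|n gn] := v_lt y (v y + e); first lra.
  have := v_le x n; have := stopped_value_Lip1 lam x0 n x y.
  by rewrite -/g; lra.
exists v => // x; apply/ler_addgt0Pr => e e0.
(* A single [n] serves all actions, so the limit passes through the inf-sup: [v x <= g n.+1 x <= S
   (g n) x - lam <= S v x + e - lam]. *)
have [|n gn] := @dini_Lip1 g v x e (stopped_value_Lip1 lam x0) vL
  (stopped_value_homo lam x0) _ e0.
  by move=> y e' e'0; apply: v_lt; lra.
have := shapley_le_add (stopped_value_Lip1 lam x0 n) vL gn.
have : g n.+1 x <= S (g n) x - lam by rewrite /g /= ge_min lexx orbT.
by have := v_le x n.+1; rewrite -/g; lra.
Qed.

End Shapley.

Theorem theorem5 (R : realType) (X A B : topologicalType)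
    (d : X -> X -> R) (T : A -> B -> X -> X)
    (X_nonempty : [set: X] !=set0)
    (d_hemi_metric : hemi_metric d)
    (X_topology : hemi_metric_topology d)
    (A_nonempty : [set: A] !=set0) (A_compact : compact [set: A])
    (B_nonempty : [set: B] !=set0) (B_compact : compact [set: B])
    (T_nonexpansive : forall a b, nonexpansive d (T a b))
    (T_assumption : game_assumption T)
    (T_almost_isometry : exists gamma : R, forall a b x y,
       d (T a b x) (T a b y) >= d x y - gamma) :
  exists rho : R,
    [/\ forall x0 : X, is_game_value d T x0 rho%:E,
        rho%:E = ereal_inf [set lam%:E | lam in
                   [set lam : R | exists2 v : X -> R, distance_like d v &
                      forall x, lam + v x >= shapley T v x]] &
        rho%:E = ereal_inf [set ereal_sup (range (fun x : X =>
                                  (shapley T v x - v x)%:E))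
                           | v in distance_like d]].
Proof.
have [[z _] [a0 _] [b0 _]] := And3 X_nonempty A_nonempty B_nonempty.
have [gamma T_ge] := T_almost_isometry; have [_ _ T_compact] := T_assumption.
have orbit_compact x : compact [set y : X | exists a b, y = T a b x].
  rewrite (_ : [set y | _] =
    [set y | exists a b x', [set x] x' /\ y = T a b x']).
    exact: (@T_compact [set x] (@compact_set1 X x)).
  apply/seteqP; split => y [a [b]]; first by exists a, b, x.
  by move=> [_ [-> yT]]; exists a, b.
set L := [set lam : R | _].
have upper lam x0 : L lam -> (upper_value d T x0 <= lam%:E)%E.
  move=> [v vD vS].
  exact: (upper_value_le a0 d_hemi_metric X_topology orbit_compact x0 vD vS).
(* The stopped game starts at the fixed [z]; its subsolution bounds the value from every [x0]. *)
have lower lam x0 : ~ L lam -> (lam%:E <= lower_value d T x0)%E.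
  move=> NL; have [n|v vL vS] := @Lip1_subsolution _ _ A B d T a0 b0
    d_hemi_metric X_topology T_nonexpansive orbit_compact lam z.
    rewrite leNgt; apply/negP => gn_lt0; apply: NL.
    exact: (distance_like_supersolution a0 b0 d_hemi_metric X_topology
      T_nonexpansive orbit_compact T_ge gn_lt0).
  exact: (lower_value_ge b0 X_topology orbit_compact x0 vL vS).
have [M zM] :=
  Lip1_bounded X_topology orbit_compact z (Lip1_dist d_hemi_metric z).
have [M' zM'] :=
  Lip1_bounded X_topology orbit_compact z (Lip1_distN d_hemi_metric z).
(* One turn increases the distance to [z] by at most the displacement of [z], bounded by [M]. *)
have LM : L M.
  exists (d^~ z).
    by split; [exact: Lip1_dist|exists z, 0 => x; rewrite addr0].
  move=> x; apply: (shapley_le (a := a0) b0 X_topology orbit_compact).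
    exact: Lip1_dist.
  move=> b; have := zM a0 b; have := T_nonexpansive a0 b x z.
  by have := hemi_metric_triangle d_hemi_metric (T a0 b x) (T a0 b z) z; lra.
(* The subsolution [- d z x] gives a real lower bound on the value, hence on [L]. *)
have lowerM' x0 : ((- M')%:E <= lower_value d T x0)%E.
  apply: (lower_value_ge b0 X_topology orbit_compact x0
    (Lip1_distN d_hemi_metric z)).
  move=> x; apply: (shapley_ge a0 X_topology orbit_compact).
    exact: Lip1_distN.
  move=> a; exists b0; have := zM' a b0; have := T_nonexpansive a b0 z x.
  by have := hemi_metric_triangle d_hemi_metric z (T a b0 z) (T a b0 x); lra.
have L_inf : has_inf L.
  split; first by exists M.
  exists (- M') => lam Llam; rewrite -lee_fin.
  apply: le_trans (lowerM' z) _.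
  exact: le_trans (lower_upper_value _ _ _) (upper _ z Llam).
have infE : (inf L)%:E = ereal_inf [set lam%:E | lam in L].
  by rewrite ereal_inf_EFin//; case: L_inf.
exists (inf L); split => //.
- move=> x0.
  have upper_le : (upper_value d T x0 <= (inf L)%:E)%E.
    rewrite infE; apply: le_ereal_inf_tmp => _ [lam Llam <-]; exact: upper.
  have lower_ge : ((inf L)%:E <= lower_value d T x0)%E.
    (* [inf L - e] lies outside [L], so Max guarantees it. *)
    apply/lee_addgt0Pr => e e0; rewrite -leeBlDr// -EFinB; apply: lower => Le.
    by have := ge_inf (proj2 L_inf) Le; lra.
  have := lower_upper_value d T x0.
  by split; apply/eqP; rewrite eq_le; apply/andP; split=> //;
    [exact: le_trans lower_ge _|exact: le_trans upper_le].
- rewrite infE; apply/eqP; rewrite eq_le; apply/andP; split.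
    apply: le_ereal_inf_tmp => _ [v vD <-].
    set s := ereal_sup _.
    have s_ge x : ((shapley T v x - v x)%:E <= s)%E.
      by apply: ereal_sup_ubound; exists x.
    (* A finite supremum belongs to [L], [+oo] is trivial, and the term at [z] excludes [-oo]. *)
    case: s s_ge => [r| |] s_ge; last by have := s_ge z.
      apply: ereal_inf_lbound; exists r => //; exists v => // x.
      by rewrite -lerBlDr -lee_fin.
    exact: leey.
  apply: le_ereal_inf_tmp => _ [lam [v vD vS] <-].
  apply: ge_ereal_inf; eexists; first by exists v.
  by apply: ge_ereal_sup => _ [x _ <-]; rewrite lee_fin lerBlDr.
Qed.
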